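(* Suppose that a group $G$ admits a general type action on a hyperbolic space $S$, and let $E_S(G)=\{g\in G\mid gs=s\ \ \forall s\in\Lambda_S(G)\}$ be its elliptic radical. Then the quotient group $G/E_S(G)$ is faithful weakly hyperbolic.
   Context: A hyperbolic space is a geodesic metric space $S$ (not assumed proper) such that for some $\delta\ge 0$, $\langle x|y\rangle_o\ge\min\{\langle x|z\rangle_o,\langle z|y\rangle_o\}-\delta$ for all $x,y,z,o\in S$, where $\langle x|y\rangle_o=\frac12(d(x,o)+d(y,o)-d(x,y))$. Its Gromov boundary $\partial S$ is the set of equivalence classes of sequences $(x_i)$ in $S$ with $\langle x_i|x_j\rangle_o\to\infty$ as $i,j\to\infty$, where $(x_i)\sim(y_i)$ iff $\langle x_i|y_j\rangle_o\to\infty$; a sequence in the class $a$ is said to converge to $a$. For $a,b\in\partial S$, $\langle a|b\rangle_o$ is the infimum of $\liminf_{i,j}\langle x_i|y_j\rangle_o$ over sequences $x_i\to a$, $y_j\to b$; $\partial S$ is topologized so that the sets $\{b\in\partial S:\langle a|b\rangle_o>r\}$, $r\ge 0$, form a neighborhood base at $a$. All group actions on hyperbolic spaces are by isometries; they extend to actions by homeomorphisms on $\partial S$. The limit set $\Lambda_S(G)\subseteq\partial S$ of a group $G$ acting on $S$ is the set of points of $\partial S$ that are limits of sequences in an orbit $Gs$ (independent of $s\in S$), with the subspace topology. An element $g\in G$ is loxodromic if $\langle g\rangle$ has unbounded orbits in $S$ and fixes exactly two points of $\partial S$. The action of $G$ on $S$ is of general type if its orbits are unbounded and $G$ contains two loxodromic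 elements with disjoint fixed point sets in $\partial S$. A group is faithful weakly hyperbolic if it admits a general type action on some hyperbolic space such that the induced action on the limit set is faithful. *)

(* Defs.v *)
From HB Require Import structures.
From mathcomp Require Import all_boot all_order all_algebra.
From mathcomp Require Import all_classical all_reals all_analysis.

Set Implicit Arguments.
Unset Strict Implicit.
Unset Printing Implicit Defensive.

Import Order.TTheory GRing.Theory Num.Theory.
Import numFieldTopology.Exports numFieldNormedType.Exports.

Local Open Scope classical_set_scope.
Local Open Scope ring_scope.

Record normal_subgroup (G : groupType) := NormalSubgroup {
  nsub_set :> G -> Prop ;
  nsub1 : nsub_set 1%g ;
  nsubM : forall g h, nsub_set g -> nsub_set h -> nsub_set (g * h)%g ;
  nsubV : forall g, nsub_set g -> nsub_set g^-1%g ;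
  nsubJ : forall g h, nsub_set g -> nsub_set (g ^ h)%g }.

Section QuotientGroup.
Variables (G : groupType) (N : normal_subgroup G).
Local Open Scope group_scope.
Local Open Scope quotient_scope.

Definition coset_rel : rel G := fun g h => `[< N (g^-1 * h) >].

Lemma coset_relP g h : reflect (N (g^-1 * h)) (coset_rel g h).
Proof. exact: asboolP. Qed.

Lemma coset_rel_refl : reflexive coset_rel.
Proof. by move=> g; apply/coset_relP; rewrite mulVg; exact: nsub1. Qed.

Lemma coset_rel_sym : symmetric coset_rel.
Proof.
by move=> g h; apply/coset_relP/coset_relP => /nsubV; rewrite invgM invgK.
Qed.

Lemma coset_rel_trans : transitive coset_rel.
Proof.
move=> h g k /coset_relP gh /coset_relP hk; apply/coset_relP.
by have := nsubM gh hk; rewrite mulgA mulgK.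
Qed.

Canonical coset_equiv :=
  EquivRel coset_rel coset_rel_refl coset_rel_sym coset_rel_trans.

Definition quotient_group := {eq_quot coset_equiv}.

HB.instance Definition _ := Choice.on quotient_group.

Lemma coset_eqP g h : reflect (\pi_quotient_group g = \pi_quotient_group h)
  (coset_rel g h).
Proof. exact: (@eqmodP _ coset_equiv). Qed.

Lemma coset_repr g : N (g^-1 * repr (\pi_quotient_group g)).
Proof. by apply/coset_relP/coset_eqP; rewrite reprK. Qed.

Definition quot_one : quotient_group := \pi_quotient_group 1.
Definition quot_mul (u v : quotient_group) : quotient_group :=
  \pi_quotient_group (repr u * repr v).
Definition quot_inv (u : quotient_group) : quotient_group :=
  \pi_quotient_group (repr u)^-1.

Lemma pi_quot_mul g h :
  \pi_quotient_group (g * h) = quot_mul (\pi_quotient_group g) (\pi_quotient_group h).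
Proof.
apply/coset_eqP/coset_relP.
have Ng := nsubJ h (coset_repr g).
have := nsubM Ng (coset_repr h).
by rewrite /conjg -!mulgA mulVKg invgM !mulgA.
Qed.

Lemma pi_quot_inv g : \pi_quotient_group g^-1 = quot_inv (\pi_quotient_group g).
Proof.
apply/coset_eqP/coset_relP; rewrite invgK.
have := nsubJ g^-1 (nsubV (coset_repr g)).
by rewrite /conjg invgM !invgK -!mulgA mulgV mulg1.
Qed.

Lemma quot_ind (P : quotient_group -> Prop) : (forall g, P (\pi_quotient_group g)) ->
  forall u, P u.
Proof. by move=> Ppi u; rewrite -[u]reprK. Qed.

Lemma quot_mulA : associative quot_mul.
Proof.
elim/quot_ind => g; elim/quot_ind => h; elim/quot_ind => k.
by rewrite -!pi_quot_mul mulgA.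
Qed.

Lemma quot_mul1g : left_id quot_one quot_mul.
Proof. by elim/quot_ind => g; rewrite -pi_quot_mul mul1g. Qed.

Lemma quot_mulg1 : right_id quot_one quot_mul.
Proof. by elim/quot_ind => g; rewrite -pi_quot_mul mulg1. Qed.

Lemma quot_mulV : left_inverse quot_one quot_inv quot_mul.
Proof. by elim/quot_ind => g; rewrite -pi_quot_inv -pi_quot_mul mulVg. Qed.

Lemma quot_Vmul : right_inverse quot_one quot_inv quot_mul.
Proof. by elim/quot_ind => g; rewrite -pi_quot_inv -pi_quot_mul mulgV. Qed.

HB.instance Definition _ := isGroup.Build quotient_group
  quot_mulA quot_mul1g quot_mulg1 quot_mulV quot_Vmul.

End QuotientGroup.

Section Hyperbolic.
Variables (R : realType) (S : metricType R).
Implicit Types (o s t : S) (x y : nat -> S).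

Definition geodesic_space := forall s t, exists c : R -> S,
  [/\ c 0 = s, c (mdist s t) = t &
      {in `[0, mdist s t] &, forall u v, mdist (c u) (c v) = `|u - v|}].

Definition gromov_product o s t : R :=
  (mdist s o + mdist t o - mdist s t) / 2.

Definition hyperbolic := geodesic_space /\
  exists2 delta : R, 0 <= delta & forall s t r o : S,
    Num.min (gromov_product o s r) (gromov_product o r t) - delta
      <= gromov_product o s t.

(* Changing the base point alters the Gromov product by a bounded amount, so
   "for all [o]" is the same as "for some [o]". *)
Definition asymptotic x y := forall o,
  gromov_product o (x p.1) (y p.2) @[p --> (\oo, \oo)] --> +oo.

Definition cvg_at_infinity x := asymptotic x x.

(* A boundary point is an equivalence class of sequences, represented as the
   set of its members: for [a] in [boundary], [a x] reads "[x] converges to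
   [a]". *)
Definition boundary : set (set (nat -> S)) :=
  [set a | exists2 x, cvg_at_infinity x &
                      a = [set y | cvg_at_infinity y /\ asymptotic x y]].

End Hyperbolic.

Record isometric_action (R : realType) (G : groupType) (S : metricType R) :=
  IsometricAction {
    iact :> G -> S -> S ;
    iact1 : forall s, iact 1%g s = s ;
    iactM : forall g h s, iact (g * h)%g s = iact g (iact h s) ;
    iact_isom : forall g s t, mdist (iact g s) (iact g t) = mdist s t }.

Definition cyclic_subgroup (G : groupType) (g : G) : set G :=
  [set h | exists n, h = (g ^+ n)%g \/ h = (g ^- n)%g].

Section Actions.
Variables (R : realType) (G : groupType) (S : metricType R).
Variable rho : isometric_action G S.
Implicit Types (g h : G) (A : set G) (a b : set (nat -> S)).

Definition bact g a : set (nat -> S) := [set rho g \o x | x in a].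

Definition limit_set : set (set (nat -> S)) :=
  [set a | boundary a /\
     exists s x, (forall n, exists g, x n = rho g s) /\ a x].

Definition boundary_fix A : set (set (nat -> S)) :=
  [set a | boundary a /\ forall g, A g -> bact g a = a].

(* On the empty space this holds vacuously, but the empty space has no
   boundary point, hence no loxodromic element and no general type action. *)
Definition unbounded_orbits A := forall s, ~ exists M : R,
  forall g h, A g -> A h -> mdist (rho g s) (rho h s) <= M.

Definition loxodromic g :=
  unbounded_orbits (cyclic_subgroup g) /\
  exists a b, a <> b /\ boundary_fix (cyclic_subgroup g) = [set a; b].

Definition general_type :=
  unbounded_orbits setT /\
  exists g h, [/\ loxodromic g, loxodromic h &
    boundary_fix [set g] `&` boundary_fix [set h] = set0].

Definition faithful_on_limit_set :=
  forall g h, (forall a, limit_set a -> bact g a = bact h a) -> g = h.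

Lemma bact1 a : bact 1%g a = a.
Proof.
have comp1 x : rho 1%g \o x = x by apply/funext => n; exact: iact1.
apply/seteqP; split => [_ [x ax <-]|x ax]; first by rewrite comp1.
by exists x.
Qed.

Lemma bactM g h a : bact (g * h)%g a = bact g (bact h a).
Proof.
have compM x : rho (g * h)%g \o x = rho g \o (rho h \o x).
  by apply/funext => n; exact: iactM.
apply/seteqP; split => [_ [x ax <-]|_ [_ [x ax <-] <-]].
  by rewrite compM; exists (rho h \o x) => //; exists x.
by rewrite -compM; exists x.
Qed.

Lemma iactK g s : rho g (rho g^-1%g s) = s.
Proof. by rewrite -iactM mulgV iact1. Qed.

Lemma iactVK g s : rho g^-1%g (rho g s) = s.
Proof. by rewrite -iactM mulVg iact1. Qed.

Lemma gromov_product_iact g o s t :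
  gromov_product (rho g o) (rho g s) (rho g t) = gromov_product o s t.
Proof. by rewrite /gromov_product !iact_isom. Qed.

Lemma asymptotic_iact g x y :
  asymptotic x y -> asymptotic (rho g \o x) (rho g \o y).
Proof.
move=> xy o; rewrite -(iactK g o) /=.
by under eq_fun do rewrite gromov_product_iact; exact: xy.
Qed.

Lemma iact_compVK g (x : nat -> S) : rho g^-1%g \o (rho g \o x) = x.
Proof. by apply/funext => n; exact: iactVK. Qed.

Lemma iact_compK g (x : nat -> S) : rho g \o (rho g^-1%g \o x) = x.
Proof. by apply/funext => n; exact: iactK. Qed.

Lemma boundary_bact g a : boundary a -> boundary (bact g a).
Proof.
move=> [x x_cvg ->]; exists (rho g \o x); first exact: asymptotic_iact.
apply/seteqP; split => [_ [y [y_cvg xy] <-]|y [y_cvg xy]].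
  by split; exact: asymptotic_iact.
exists (rho g^-1%g \o y); last exact: iact_compK.
split; first exact: asymptotic_iact.
by rewrite -(iact_compVK g x); exact: asymptotic_iact.
Qed.

Lemma limit_set_bact g a : limit_set a -> limit_set (bact g a).
Proof.
move=> [ba [s [x [xs ax]]]]; split; first exact: boundary_bact.
exists s, (rho g \o x); split; last by exists x.
by move=> n; have [h xh] := xs n; exists (g * h)%g; rewrite /= xh iactM.
Qed.

Definition elliptic_radical_set : set G :=
  [set g | forall a, limit_set a -> bact g a = a].

Lemma elliptic_radical1 : elliptic_radical_set 1%g.
Proof. by move=> a _; exact: bact1. Qed.

Lemma elliptic_radicalM g h : elliptic_radical_set g ->
  elliptic_radical_set h -> elliptic_radical_set (g * h)%g.
Proof. by move=> Eg Eh a La; rewrite bactM Eh // Eg. Qed.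

Lemma elliptic_radicalV g : elliptic_radical_set g ->
  elliptic_radical_set g^-1%g.
Proof. by move=> Eg a La; rewrite -{1}(Eg a La) -bactM mulVg bact1. Qed.

Lemma elliptic_radicalJ g h : elliptic_radical_set g ->
  elliptic_radical_set (g ^ h)%g.
Proof.
move=> Eg a La; rewrite /conjg !bactM Eg; last exact: limit_set_bact.
by rewrite -bactM mulVg bact1.
Qed.

Definition elliptic_radical : normal_subgroup G := NormalSubgroup
  elliptic_radical1 elliptic_radicalM elliptic_radicalV elliptic_radicalJ.

End Actions.

Definition faithful_weakly_hyperbolic (R : realType) (G : groupType) :=
  exists (S : metricType R) (rho : isometric_action G S),
    [/\ hyperbolic S, general_type rho & faithful_on_limit_set rho].

(* Main.v *)
(* Three pairwise distinct boundary points have a coarse centre, so a group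
   fixing three of them moves every point a bounded amount; this applies to the
   elliptic radical N, as general type provides four points of the limit set.
   The new space T is the set of N-fixed points of the injective hull (tight
   span) of S: the functions f : S -> R that are minimal subject to
   d(x, y) <= f x + f y, with the sup distance, restricted to the N-invariant
   ones. It is geodesic, because a 1-Lipschitz equivariant retraction projects
   affine segments to T, it inherits the hyperbolicity constant of S, and G/N
   acts on it. A bounded N-orbit yields a point of T whose G/N-orbit is at
   bounded distance from a G-orbit in S, so limit sets correspond and
   faithfulness is clear. An element is loxodromic iff the sequences g^n s and
   g^-n s converge to two distinct boundary points, a property which only
   depends on the orbit. *)
Require Import Defs.
From HB Require Import structures.
From mathcomp Require Import all_boot all_order all_algebra.
From mathcomp Require Import all_classical all_reals all_analysis.
From mathcomp Require Import lra zify ring.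

Set Implicit Arguments.
Unset Strict Implicit.
Unset Printing Implicit Defensive.

Import Order.TTheory GRing.Theory Num.Theory.
Import numFieldTopology.Exports numFieldNormedType.Exports.

Local Open Scope classical_set_scope.
Local Open Scope ring_scope.

(** * Gromov products and convergence at infinity *)

Section GromovProduct.
Variables (R : realType) (S : metricType R).
Implicit Types (o p q r s t : S) (x y z : nat -> S).

Lemma gromov_productC o s t : gromov_product o s t = gromov_product o t s.
Proof. by rewrite /gromov_product (metric_sym s t); lra. Qed.

Lemma gromov_product_base o p s t :
  gromov_product p s t - mdist o p <= gromov_product o s t.
Proof.
have := metric_triangle s o p; have := metric_triangle t o p.
by rewrite /gromov_product; lra.
Qed.

Lemma gromov_product_approx o p r s t u B : mdist o p <= B -> mdist r s <= B ->
  mdist t u <= B -> gromov_product o r t - 3 * B <= gromov_product p s u.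
Proof.
move=> op rs tu; have := metric_triangle r s o; have := metric_triangle s p o.
have := metric_triangle t u o; have := metric_triangle u p o.
have := metric_triangle s r u; have := metric_triangle r t u.
by rewrite /gromov_product (metric_sym p o) (metric_sym s r); lra.
Qed.

Lemma asymptoticP x y : asymptotic x y <-> forall o M, exists N, forall i j,
  (N <= i)%N -> (N <= j)%N -> M <= gromov_product o (x i) (y j).
Proof.
split=> [xy o M|xy o].
  have /cvgryPge/(_ M) := xy o.
  move=> [[A B] /= [[N1 _ AN1] [N2 _ BN2]] ABM].
  exists (maxn N1 N2) => i j; rewrite !geq_max => /andP[iN1 _] /andP[_ jN2].
  by apply: (ABM (i, j)); split; [exact: AN1|exact: BN2].
apply/cvgryPge => M; have [N NM] := xy o M.
by exists ([set n | (N <= n)%N], [set n | (N <= n)%N]) => /=;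
  [split; exists N|move=> [i j] [/= iN jN]; exact: NM].
Qed.

(** One base point suffices: moving it to [p] costs at most [mdist p o]. *)
Lemma asymptotic_base o x y : (forall M, exists N, forall i j,
  (N <= i)%N -> (N <= j)%N -> M <= gromov_product o (x i) (y j)) ->
  asymptotic x y.
Proof.
move=> xy; apply/asymptoticP => p M; have [N NM] := xy (M + mdist p o).
exists N => i j Ni Nj; have := gromov_product_base p o (x i) (y j).
by have := NM i j Ni Nj; lra.
Qed.

Lemma asymptotic_sym x y : asymptotic x y -> asymptotic y x.
Proof.
move=> /asymptoticP xy; apply/asymptoticP => o M; have [N NM] := xy o M.
by exists N => i j Ni Nj; rewrite gromov_productC; exact: NM.
Qed.

Lemma asymptotic_bounded B x x' y y' :
  (forall n, mdist (x n) (x' n) <= B) -> (forall n, mdist (y n) (y' n) <= B) ->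
  asymptotic x y -> asymptotic x' y'.
Proof.
move=> xx' yy' /asymptoticP xy; apply/asymptoticP => o M.
have [N NM] := xy o (M + 3 * B); exists N => i j Ni Nj.
have B0 : mdist o o <= B by rewrite mdistxx (le_trans _ (xx' 0%N)) ?mdist_ge0.
have := gromov_product_approx B0 (xx' i) (yy' j).
by have := NM i j Ni Nj; lra.
Qed.

(** The index maps need not be monotone; the case used is the shift by one. *)
Lemma asymptotic_subseq (f g : nat -> nat) x y :
  (forall n, (n <= f n)%N) -> (forall n, (n <= g n)%N) ->
  asymptotic x y -> asymptotic (x \o f) (y \o g).
Proof.
move=> nf ng /asymptoticP xy; apply/asymptoticP => o M; have [N NM] := xy o M.
exists N => i j Ni Nj.
by apply: NM; [exact: leq_trans Ni (nf i)|exact: leq_trans Nj (ng j)].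
Qed.

Definition boundary_point x : set (nat -> S) :=
  [set y | cvg_at_infinity y /\ asymptotic x y].

Lemma boundary_boundary_point x :
  cvg_at_infinity x -> boundary (boundary_point x).
Proof. by exists x. Qed.

Lemma boundary_point_asymptotic x y :
  cvg_at_infinity y -> boundary_point x = boundary_point y -> asymptotic x y.
Proof. by move=> yc xy; have [] : boundary_point x y by rewrite xy. Qed.

(** * Consequences of the hyperbolicity inequality *)

Variable delta : R.
Hypothesis delta_hyp : forall s t r o : S,
  Num.min (gromov_product o s r) (gromov_product o r t) - delta
    <= gromov_product o s t.

(** The minimum is split into two cases so that linear arithmetic applies. *)
Lemma hyperbolic_or s t r o : gromov_product o s r - delta <= gromov_product o s t
  \/ gromov_product o r t - delta <= gromov_product o s t.
Proof.
have := delta_hyp s t r o.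
by rewrite minEle; case: ifP => _ H; [left|right].
Qed.

Lemma hyperbolic_ge m s t r o : m + delta <= gromov_product o s r ->
  m + delta <= gromov_product o r t -> m <= gromov_product o s t.
Proof. by move=> sr rt; case: (hyperbolic_or s t r o) => ?; lra. Qed.

Lemma hyperbolic_ge3 m r s t u o : m + 2 * delta <= gromov_product o r s ->
  m + 2 * delta <= gromov_product o s t ->
  m + 2 * delta <= gromov_product o t u ->
  0 <= delta -> m <= gromov_product o r u.
Proof.
move=> rs st tu d0; apply: (@hyperbolic_ge _ _ _ t); last lra.
by apply: (@hyperbolic_ge _ _ _ s); lra.
Qed.

Lemma asymptotic_trans x y z :
  asymptotic x y -> asymptotic y z -> asymptotic x z.
Proof.
move=> /asymptoticP xy /asymptoticP yz; apply/asymptoticP => o M.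
have [N1 N1M] := xy o (M + delta); have [N2 N2M] := yz o (M + delta).
exists (maxn N1 N2) => i j; rewrite !geq_max => /andP[iN1 iN2] /andP[jN1 jN2].
by apply: (@hyperbolic_ge _ _ _ (y (maxn N1 N2))); [apply: N1M|apply: N2M];
  rewrite // ?leq_maxl ?leq_maxr.
Qed.

Lemma boundary_point_eq x y :
  asymptotic x y -> boundary_point x = boundary_point y.
Proof.
move=> xy; apply/seteqP; split=> z [zc xz]; split=> //.
  exact: asymptotic_trans (asymptotic_sym xy) xz.
exact: asymptotic_trans xy xz.
Qed.

Lemma boundary_point_of a x : boundary a -> a x ->
  cvg_at_infinity x /\ a = boundary_point x.
Proof.
by move=> [y yc ->] [xc yx]; split=> //; exact: boundary_point_eq.
Qed.

Hypothesis delta0 : 0 <= delta.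

(** If the tails had unbounded products, one large product of some [x i] and [y j] would spread
    along the chain [x k], [x i], [y j], [y l] to all later pairs, making the sequences
    asymptotic. *)
Lemma non_asymptotic_bounded o x y : cvg_at_infinity x -> cvg_at_infinity y ->
  ~ asymptotic x y -> exists M N, forall i j,
    (N <= i)%N -> (N <= j)%N -> gromov_product o (x i) (y j) <= M.
Proof.
move=> /asymptoticP/(_ o) xc /asymptoticP/(_ o) yc nxy.
apply: contrapT => unbd; apply: nxy; apply: (@asymptotic_base o) => M.
have [N1 N1M] := xc (M + 2 * delta); have [N2 N2M] := yc (M + 2 * delta).
apply: contrapT => nM; apply: unbd; exists (M + 2 * delta), (maxn N1 N2).
move=> i j; rewrite !geq_max => /andP[iN1 _] /andP[_ jN2].
rewrite leNgt; apply/negP => lt_ij; apply: nM; exists (maxn N1 N2).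
move=> k l; rewrite !geq_max => /andP[kN1 _] /andP[_ lN2].
by apply: (@hyperbolic_ge3 _ _ (x i) (y j)); rewrite ?(ltW lt_ij) ?N1M ?N2M.
Qed.

(* The point is a coarse centre of the triangle [x y z]: for both base points at
   most one of [x, y, z] has a large product with the other base point, so one
   vertex [w] has both products small, and these add up to [mdist p q]. *)
Lemma coarse_centre_unique M p q (x y z : S) :
  gromov_product p x y <= M -> gromov_product p y z <= M ->
  gromov_product p x z <= M -> gromov_product q x y <= M ->
  gromov_product q y z <= M -> gromov_product q x z <= M ->
  mdist p q <= 2 * (M + delta).
Proof.
move=> pxy pyz pxz qxy qyz qxz.
have small o u v r : gromov_product o u v <= M ->
    gromov_product o u r <= M + delta \/ gromov_product o r v <= M + delta.
  by move=> ouv; case: (hyperbolic_or u v r o) => ?; [left|right]; lra.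
have close w : gromov_product p w q <= M + delta ->
    gromov_product q w p <= M + delta -> mdist p q <= 2 * (M + delta).
  by rewrite /gromov_product (metric_sym q p); lra.
have [pxq|pqy] := small _ _ _ q pxy; have [qxp|qpy] := small _ _ _ p qxy.
- exact: close qxp.
- have [qxp|qpz] := small _ _ _ p qxz; first exact: close qxp.
  have [pyq|pqz] := small _ _ _ q pyz.
    by apply: close pyq _; rewrite gromov_productC.
  by apply: (close z); rewrite gromov_productC.
- have [pxq|pqz] := small _ _ _ q pxz; first exact: close qxp.
  have [qyp|qpz] := small _ _ _ p qyz.
    by apply: close _ qyp; rewrite gromov_productC.
  by apply: (close z); rewrite gromov_productC.
- by apply: (close y); rewrite gromov_productC.
Qed.

Lemma four_point p q s t : mdist p q + mdist s t <= mdist p s + mdist q t + 2 * delta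
  \/ mdist p q + mdist s t <= mdist p t + mdist q s + 2 * delta.
Proof.
rewrite (metric_sym p s) (metric_sym q t) (metric_sym q s).
by case: (hyperbolic_or s t p q); rewrite /gromov_product => ?; [left|right]; lra.
Qed.

(** The difference of distances to [p] and [q] is a coarse Busemann function of the common boundary
    point. Of the three pairings of [x i], [y j], [p], [q], the one containing [mdist (x i) (y j)]
    is the smallest, so the other two nearly agree. *)
Lemma busemann_asymptotic p q x y : asymptotic x y ->
  exists N, forall i j, (N <= i)%N -> (N <= j)%N ->
    `|(mdist (x i) p - mdist (x i) q) - (mdist (y j) p - mdist (y j) q)|
      <= 2 * delta.
Proof.
(* This threshold rules out the first alternative in both uses of [four_point] below. *)
move=> /asymptoticP/(_ p (mdist p q + delta + 1))[N NM]; exists N => i j Ni Nj.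
have := NM i j Ni Nj; rewrite /gromov_product => far.
have := metric_triangle (x i) q p; have := metric_triangle (y j) q p.
have := four_point (x i) p (y j) q; have := four_point (x i) q (y j) p.
rewrite ?(metric_sym q p) ?(metric_sym p (y j)) ?(metric_sym q (y j)).
by rewrite ler_norml => -[] ? [] ? ? ?; apply/andP; split; lra.
Qed.

End GromovProduct.

(** * Elements with two endpoints are loxodromic *)

Lemma bounded_prefix (R : realType) (f : nat -> R) N :
  exists B, forall n, (n < N)%N -> f n <= B.
Proof.
elim: N => [|N [B fB]]; first by exists 0.
exists (Num.max B (f N)) => n; rewrite ltnS leq_eqVlt => /orP[/eqP->|/fB fnB].
  by rewrite le_max lexx orbT.
by rewrite le_max fnB.
Qed.

(** Along multiples of [N] the values grow at least linearly with slope [f N - c]; the remainder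
    modulo [N] takes finitely many values. *)
Lemma quasimorphism_diverges (R : realType) (f : nat -> R) c N :
  (forall n m, `|f (n + m)%N - f n - f m| <= c) -> c < f N ->
  forall M, exists n0, forall n, (n0 <= n)%N -> M <= f n.
Proof.
move=> fqm cN M.
have fqm2 n m : f n + f m - c <= f (n + m)%N <= f n + f m + c.
  by have := fqm n m; rewrite ler_norml => /andP[? ?]; apply/andP; split; lra.
(* Quasi-additivity at 0 gives [f 0 <= c], so [N] is not 0. *)
have N0 : (0 < N)%N.
  by case: N cN => // cN; have := fqm2 0%N 0%N; rewrite addn0 => /andP[? ?]; lra.
have fmul k : k%:R * (f N - c) - c <= f (k * N)%N.
  elim: k => [|k IHk].
    by rewrite mul0n; have := fqm2 0%N 0%N; rewrite addn0 => /andP[? ?]; lra.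
  by rewrite mulSn addnC -natr1 mulrDl; have := fqm2 (k * N)%N N; lra.
have [B fB] := bounded_prefix (fun n => - f n) N.
have eps0 : 0 < f N - c by lra.
(* One [c] pays for splitting off the remainder, the other for the error in [fmul]; [B] bounds the
   remainder term. *)
have [k kM] : exists k : nat, (M + 2 * c + B) / (f N - c) < k%:R.
  exists (Num.truncn `|(M + 2 * c + B) / (f N - c)|).+1.
  by rewrite (le_lt_trans (ler_norm _))// truncnS_gt.
exists (k * N)%N => n kn; rewrite ltr_pdivrMr// in kM.
have kdiv : (k <= n %/ N)%N by rewrite leq_divRL.
have /andP[fn _] := fqm2 (n %/ N * N)%N (n %% N)%N; rewrite -divn_eq in fn.
have := fB _ (ltn_pmod n N0); have := fmul (n %/ N)%N.
have : k%:R * (f N - c) <= (n %/ N)%:R * (f N - c).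
  by rewrite ler_wpM2r ?ler_nat// ltW.
lra.
Qed.

Section BoundaryAction.
Variables (R : realType) (G : groupType) (S : metricType R).
Variable rho : isometric_action G S.
Implicit Types (g h : G) (s t : S) (x y z : nat -> S).

Lemma bact_boundary_point g x :
  bact rho g (boundary_point x) = boundary_point (rho g \o x).
Proof.
apply/seteqP; split=> [_ [y [yc xy] <-]|y [yc xy]].
  by split; exact: asymptotic_iact.
exists (rho g^-1%g \o y); last exact: iact_compK.
split; first exact: asymptotic_iact.
by rewrite -(iact_compVK rho g x); exact: asymptotic_iact.
Qed.

Lemma asymptotic_fixV g x :
  asymptotic (rho g \o x) x -> asymptotic (rho g^-1%g \o x) x.
Proof.
move=> /(asymptotic_iact rho g^-1%g); rewrite iact_compVK.
exact: asymptotic_sym.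
Qed.

Lemma iactX_comp g n x : rho (g ^+ n.+1)%g \o x = rho g \o (rho (g ^+ n)%g \o x).
Proof. by apply/funext => i /=; rewrite -iactM expgS. Qed.

(** * Orbits of cyclic groups and their endpoints *)

Definition power_orbit g s : nat -> S := fun n => rho (g ^+ n)%g s.

(** This form of loxodromy speaks only of one orbit, so it can be carried to any space with a
    coarsely isometric orbit. *)
Definition axial g s := [/\ cvg_at_infinity (power_orbit g s),
  cvg_at_infinity (power_orbit g^-1%g s) &
  ~ asymptotic (power_orbit g s) (power_orbit g^-1%g s)].

(** Applying [g] shifts the sequence of powers by one index. *)
Lemma power_orbit_fix g s : cvg_at_infinity (power_orbit g s) ->
  asymptotic (rho g \o power_orbit g s) (power_orbit g s).
Proof.
have -> : rho g \o power_orbit g s = power_orbit g s \o succn.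
  by apply/funext => n; rewrite /power_orbit /= expgS iactM.
by rewrite -[X in asymptotic _ X -> _]/(power_orbit g s) => /(@asymptotic_subseq
  _ _ succn id); exact.
Qed.

Lemma power_orbitV_fix g s : cvg_at_infinity (power_orbit g^-1%g s) ->
  asymptotic (rho g \o power_orbit g^-1%g s) (power_orbit g^-1%g s).
Proof. by move=> /power_orbit_fix/asymptotic_fixV; rewrite invgK. Qed.

Lemma mdist_power_orbit g s n m : (m <= n)%N ->
  mdist (power_orbit g s n) (power_orbit g s m)
    = mdist (power_orbit g s (n - m)%N) s.
Proof.
move=> mn; rewrite /power_orbit -{1}(subnKC mn) expgnDr iactM.
exact: iact_isom.
Qed.

Lemma mdist_power_orbitV g s n m :
  mdist (power_orbit g s n) (power_orbit g^-1%g s m)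
    = mdist (power_orbit g s (n + m)%N) s.
Proof.
rewrite /power_orbit addnC expgnDr iactM expVgn.
by rewrite -(iact_isom rho (g ^+ m)%g) iactK.
Qed.

Lemma mdist_power_orbitV0 g s n :
  mdist (power_orbit g^-1%g s n) s = mdist (power_orbit g s n) s.
Proof.
rewrite /power_orbit expVgn -(iact_isom rho (g ^+ n)%g) iactK.
exact: metric_sym.
Qed.

Lemma cvg_at_infinity_unbounded o x B :
  cvg_at_infinity x -> exists n, B < mdist o (x n).
Proof.
move=> /asymptoticP/(_ o (B + 1))[N NB]; exists N; have := NB N N (leqnn N).
by rewrite leqnn /gromov_product mdistxx metric_sym => /(_ isT); lra.
Qed.

(** Here [f] is a signed displacement. For [j <= i] the product at [s] is half of the displacement
    of [i] plus that of [j] minus that of [i - j], which is about [f j]. *)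
Lemma power_orbit_cvg (f : nat -> R) c C g s :
  (forall n m, `|f (n + m)%N - f n - f m| <= c) ->
  (forall n, `|mdist (power_orbit g s n) s - `|f n| | <= C) ->
  (forall M, exists N, forall n, (N <= n)%N -> M <= f n) ->
  cvg_at_infinity (power_orbit g s).
Proof.
move=> fqm fD finfty; apply: (@asymptotic_base _ _ s) => M.
have [N0 N0f] := finfty 0; have [B fB] := bounded_prefix (fun n => - f n) N0.
(* The difference [i - j] may be small even when [i] and [j] are large, so [f] must be bounded below
   everywhere to control its absolute value. *)
have {}fB n : - `|B| <= f n.
  have [/N0f f0|/fB] := leqP N0 n; first by have := normr_ge0 B; lra.
  by have := ler_norm B; lra.
have [N1 N1f] := finfty (M + c + 3 * C + 3 * `|B|).
exists (maxn N0 N1) => i j; rewrite !geq_max.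
wlog ji : i j / (j <= i)%N.
  move=> H iN jN; case/orP: (leq_total j i) => ij; first exact: H.
  by rewrite gromov_productC; exact: H.
move=> /andP[iN0 iN1] /andP[jN0 jN1].
rewrite /gromov_product mdist_power_orbit//.
have := fqm (i - j)%N j; rewrite subnK// => fij.
have := fD i; have := fD j; have := fD (i - j)%N.
have := N0f _ iN0 => fi0; have := N0f _ jN0 => fj0.
have fij_norm : `|f (i - j)%N| <= f (i - j)%N + 2 * `|B|.
  rewrite ler_norml; have := fB (i - j)%N; have := normr_ge0 B => ? ?.
  by apply/andP; split; lra.
rewrite (ger0_norm fi0) (ger0_norm fj0); move: fij; rewrite !ler_norml.
move=> /andP[? ?] /andP[? ?] /andP[? ?] /andP[? ?].
have := N1f _ iN1; have := N1f _ jN1; have := normr_ge0 B; lra.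
Qed.

(** Powers of [g] and of its inverse have equal displacements, so both half orbits converge. Their
    products at equal indices stay bounded because [f (n + n)] is about twice [f n], so the limits
    differ. *)
Lemma quasimorphism_axial (f : nat -> R) c C g s :
  (forall n m, `|f (n + m)%N - f n - f m| <= c) ->
  (forall n, `|mdist (power_orbit g s n) s - `|f n| | <= C) ->
  (forall M, exists N, forall n, (N <= n)%N -> M <= f n) ->
  axial g s.
Proof.
move=> fqm fD finfty; split; first exact: (power_orbit_cvg fqm fD).
  by apply: (power_orbit_cvg fqm _ finfty) => n; rewrite mdist_power_orbitV0.
have [N0 N0f] := finfty 0.
move=> /asymptoticP/(_ s (c + 3 * C + 1))[N NM].
pose n := maxn N N0; have := NM n n; rewrite leq_maxl => /(_ isT isT).
rewrite /gromov_product mdist_power_orbitV mdist_power_orbitV0.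
have fn0 : 0 <= f n by apply: N0f; rewrite leq_maxr.
have := fD n; have := fD (n + n)%N; have := fqm n n.
rewrite (ger0_norm fn0) !ler_norml; have := ler_norm (f (n + n)%N).
by move=> ? /andP[? ?] /andP[? ?] /andP[? ?]; lra.
Qed.

Lemma boundary_fix1P g a :
  boundary_fix rho [set g] a <-> boundary a /\ bact rho g a = a.
Proof. by split=> [[ba] /(_ g erefl)|[ba ga]]; split=> // _ ->. Qed.

Variable delta : R.
Hypothesis delta_hyp : forall s t r o : S,
  Num.min (gromov_product o s r) (gromov_product o r t) - delta
    <= gromov_product o s t.
Hypothesis delta0 : 0 <= delta.

Lemma bact_fixP g x : cvg_at_infinity x ->
  bact rho g (boundary_point x) = boundary_point x <-> asymptotic (rho g \o x) x.
Proof.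
move=> xc; rewrite bact_boundary_point.
by split=> [/(boundary_point_asymptotic xc)//|/(boundary_point_eq delta_hyp)].
Qed.

Lemma asymptotic_fixX g x n :
  asymptotic (rho g \o x) x -> cvg_at_infinity x ->
  asymptotic (rho (g ^+ n)%g \o x) x.
Proof.
move=> gx xc; elim: n => [|n IHn].
  have -> // : rho (g ^+ 0)%g \o x = x.
  by apply/funext => i /=; rewrite expg0 iact1.
rewrite iactX_comp; apply: asymptotic_trans gx => //.
exact: asymptotic_iact.
Qed.

Lemma asymptotic_fix_cyclic g h x : cyclic_subgroup g h ->
  asymptotic (rho g \o x) x -> cvg_at_infinity x ->
  asymptotic (rho h \o x) x.
Proof.
move=> [n [|]->] gx xc; first exact: asymptotic_fixX.
exact/asymptotic_fixV/asymptotic_fixX.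
Qed.

Lemma gromov_product_fix M g s (x y : S) : gromov_product s x y <= M ->
  M + 1 + 2 * delta <= gromov_product (rho g s) (rho g x) x ->
  M + 1 + 2 * delta <= gromov_product (rho g s) (rho g y) y ->
  gromov_product (rho g s) x y <= M + 1 + 2 * delta.
Proof.
move=> xyM gx gy; rewrite leNgt; apply/negP => lt_xy.
have := hyperbolic_ge3 delta_hyp gx (ltW lt_xy); rewrite gromov_productC in gy.
by move=> /(_ _ gy delta0); rewrite gromov_product_iact => ?; lra.
Qed.

(** Far out along the three sequences, [s] and [rho g s] are both coarse centres of the same
    triangle. The triangle depends on [g], the bound does not. *)
Lemma fix3_bounded (A : set G) s x y z :
  cvg_at_infinity x -> cvg_at_infinity y -> cvg_at_infinity z ->
  ~ asymptotic x y -> ~ asymptotic y z -> ~ asymptotic x z ->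
  (forall g, A g -> [/\ asymptotic (rho g \o x) x, asymptotic (rho g \o y) y &
    asymptotic (rho g \o z) z]) ->
  exists B, forall g, A g -> mdist s (rho g s) <= B.
Proof.
move=> xc yc zc nxy nyz nxz Afix.
have [M1 [N1 xyM]] := non_asymptotic_bounded delta_hyp delta0 s xc yc nxy.
have [M2 [N2 yzM]] := non_asymptotic_bounded delta_hyp delta0 s yc zc nyz.
have [M3 [N3 xzM]] := non_asymptotic_bounded delta_hyp delta0 s xc zc nxz.
pose M := Num.max M1 (Num.max M2 M3); pose L := M + 1 + 2 * delta.
exists (2 * (L + delta)) => g /Afix[].
move=> /asymptoticP/(_ (rho g s) L)[N4 gx] /asymptoticP/(_ (rho g s) L)[N5 gy].
move=> /asymptoticP/(_ (rho g s) L)[N6 gz].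
(* The sum is an index past all six thresholds. *)
pose i := (N1 + N2 + N3 + N4 + N5 + N6)%N.
have gxi : L <= gromov_product (rho g s) (rho g (x i)) (x i).
  by apply: gx; rewrite /i; lia.
have gyi : L <= gromov_product (rho g s) (rho g (y i)) (y i).
  by apply: gy; rewrite /i; lia.
have gzi : L <= gromov_product (rho g s) (rho g (z i)) (z i).
  by apply: gz; rewrite /i; lia.
have xyi : gromov_product s (x i) (y i) <= M.
  by rewrite /M !le_max xyM // /i; lia.
have yzi : gromov_product s (y i) (z i) <= M.
  by rewrite /M !le_max yzM ?orbT // /i; lia.
have xzi : gromov_product s (x i) (z i) <= M.
  by rewrite /M !le_max xzM ?orbT // /i; lia.
have ML : M <= L by rewrite /L -addrA lerDl addr_ge0// mulr_ge0.
by apply: (coarse_centre_unique delta_hyp (x := x i) (y := y i) (z := z i));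
  rewrite ?gromov_product_fix//; exact: le_trans ML.
Qed.

(** A third fixed point would give the cyclic subgroup three distinct fixed points, hence a bounded
    orbit, while the powers of [g] carry [s] to infinity. *)
Lemma axial_fix g s a : axial g s -> boundary a -> bact rho g a = a ->
  a = boundary_point (power_orbit g s) \/
  a = boundary_point (power_orbit g^-1%g s).
Proof.
move=> [pc mc npm] [z zc ->] /(bact_fixP g zc) gz.
apply: contrapT => /not_orP[zp zm].
have npz : ~ asymptotic (power_orbit g s) z.
  by move=> /asymptotic_sym/(boundary_point_eq delta_hyp).
have nmz : ~ asymptotic (power_orbit g^-1%g s) z.
  by move=> /asymptotic_sym/(boundary_point_eq delta_hyp).
have [|B DB] := fix3_bounded (A := cyclic_subgroup g) s pc mc zc npm nmz npz.
  by move=> h gh; split; apply: (asymptotic_fix_cyclic gh) => //;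
    [exact: power_orbit_fix|exact: power_orbitV_fix].
have [n] := cvg_at_infinity_unbounded s B pc.
by rewrite ltNge DB//; exists n; left.
Qed.

Lemma axial_loxodromic g s : axial g s -> loxodromic rho g.
Proof.
move=> ax; have [pc mc npm] := ax; split.
  move=> t [M tM].
  have [n] := cvg_at_infinity_unbounded s (2 * mdist s t + M) pc.
  have := tM (g ^+ 0)%g (g ^+ n)%g; rewrite expg0 iact1 => tn.
  have {}tn : mdist t (rho (g ^+ n)%g t) <= M.
    by apply: tn; [exists 0%N; left; rewrite expg0|exists n; left].
  have := metric_triangle s t (power_orbit g s n).
  have := metric_triangle t (rho (g ^+ n)%g t) (power_orbit g s n).
  by rewrite iact_isom (metric_sym t s); lra.
exists (boundary_point (power_orbit g s)).
exists (boundary_point (power_orbit g^-1%g s)); split.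
  by move=> /(boundary_point_asymptotic mc).
apply/seteqP; split=> [a [ba gfix]|a]; last first.
  move=> [|]->; split=> [|h gh]; try exact: boundary_boundary_point.
    apply/(bact_fixP _ pc)/(asymptotic_fix_cyclic gh) => //.
    exact: power_orbit_fix.
  apply/(bact_fixP _ mc)/(asymptotic_fix_cyclic gh) => //.
  exact: power_orbitV_fix.
by apply: axial_fix => //; apply: gfix; exists 1%N; left; rewrite expg1.
Qed.

End BoundaryAction.

(** * Loxodromic elements have two endpoints *)

Section LoxodromicAxial.
Variables (R : realType) (G : groupType) (S : metricType R).
Variable rho : isometric_action G S.
Variable delta : R.
Hypothesis delta_hyp : forall s t r o : S,
  Num.min (gromov_product o s r) (gromov_product o r t) - delta
    <= gromov_product o s t.
Hypothesis delta0 : 0 <= delta.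

(** Small products place [p] and [q] near a geodesic from [x] to [y], along which their distance is
    the difference of the distances to [x]. *)
Lemma busemann_dist L p q (x y : S) :
  gromov_product p x y <= L -> gromov_product q x y <= L ->
  `|mdist p q - `|mdist x p - mdist x q| | <= 2 * (L + delta).
Proof.
move=> pL qL; have := metric_triangle x p q; have := metric_triangle x q p.
rewrite (metric_sym q p) => tq tp; have pq0 := mdist_ge0 p q.
(* Products with the base point vanish, so inserting [p] between [x] and [y] bounds their product at
   [p] below by [- delta]. *)
have Ld0 : 0 <= L + delta.
  have := hyperbolic_or delta_hyp x y p p; move: pL.
  by rewrite /gromov_product !mdistxx (metric_sym p y) => ? []; lra.
have le_norm : `|mdist x p - mdist x q| <= mdist p q.
  by rewrite ler_norml; apply/andP; split; lra.
have norm_ge : mdist p q <= `|mdist x p - mdist x q| + 2 * (L + delta).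
  have := ler_norm (mdist x p - mdist x q).
  have := ler_norm (mdist x q - mdist x p); rewrite distrC.
  move: pL qL (hyperbolic_or delta_hyp x y q p) (hyperbolic_or delta_hyp x y p q).
  rewrite /gromov_product (metric_sym q p) (metric_sym q y) (metric_sym p y).
  by move=> ? ? [] ? [] ? ? ?; lra.
by rewrite ler_norml; apply/andP; split; lra.
Qed.

(** The coarse Busemann function at one fixed point, read along the orbit, is a quasimorphism whose
    absolute value is the displacement up to a constant. Unboundedness of the orbit makes it
    diverge. *)
Lemma loxodromic_axial g s : loxodromic rho g -> axial rho g s.
Proof.
move=> [unb [a [b [ab fixab]]]].
have [[x xc ax] afix] : boundary_fix rho (cyclic_subgroup g) a.
  by rewrite fixab; left.
have [[y yc by_] bfix] : boundary_fix rho (cyclic_subgroup g) b.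
  by rewrite fixab; right.
have gg : cyclic_subgroup g g by exists 1%N; left; rewrite expg1.
have gx : asymptotic (rho g \o x) x.
  by apply/(bact_fixP rho delta_hyp g xc); rewrite -[boundary_point x]ax afix.
have gy : asymptotic (rho g \o y) y.
  by apply/(bact_fixP rho delta_hyp g yc); rewrite -[boundary_point y]by_ bfix.
have nxy : ~ asymptotic x y.
  move=> /(boundary_point_eq delta_hyp); rewrite -[boundary_point x]ax.
  by rewrite -[boundary_point y]by_.
have gXx n := asymptotic_fixX delta_hyp n gx xc.
have gXy n := asymptotic_fixX delta_hyp n gy yc.
have [M [N0 xyM]] := non_asymptotic_bounded delta_hyp delta0 s xc yc nxy.
pose q := power_orbit rho g s.
(* The differences need not converge in [i]; a value within [2 * delta] of all late ones is
   chosen. *)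
have /choice[f fP] n : exists v, exists N, forall i, (N <= i)%N ->
    `|mdist (x i) (q n) - mdist (x i) s - v| <= 2 * delta.
  have [N NP] := busemann_asymptotic delta_hyp (q n) s xc.
  exists (mdist (x N) (q n) - mdist (x N) s), N => i Ni.
  by apply: NP; rewrite ?leqnn.
(* The step from [q n] to [q (n + m)] is the step from [s] to [q m] moved by the [n]-th power of
   [g], which fixes the class of [x]. Three values of [f] and one change of sequence cost
   [2 * delta] each. *)
have fqm n m : `|f (n + m)%N - f n - f m| <= 8 * delta.
  have [N1 N1P] := fP (n + m)%N; have [N2 N2P] := fP n; have [N3 N3P] := fP m.
  have [N4 N4P] := busemann_asymptotic delta_hyp (q (n + m)%N) (q n) (gXx n).
  pose i := (N1 + N2 + N3 + N4)%N.
  have /N1P : (N1 <= i)%N by rewrite /i; lia.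
  have /N2P : (N2 <= i)%N by rewrite /i; lia.
  have /N3P : (N3 <= i)%N by rewrite /i; lia.
  have iN4 : (N4 <= i)%N by rewrite /i; lia.
  have := N4P i i iN4 iN4.
  rewrite /q /power_orbit /= expgnDr (iactM rho (g ^+ n)%g) !iact_isom !ler_norml.
  move=> /andP[? ?] /andP[? ?] /andP[? ?] /andP[? ?].
  by apply/andP; split; lra.
(* [L] bounds the products of [x i] and [y i] at every [q n]; the last term of [C] is the error in
   the choice of [f]. *)
pose L := M + 1 + 2 * delta; pose C := 2 * (L + delta) + 2 * delta.
have fD n : `|mdist (q n) s - `|f n| | <= C.
  have [N1 N1P] := fP n; have := gXx n.
  move=> /asymptoticP/(_ (q n) L)[N2 N2P]; have := gXy n.
  move=> /asymptoticP/(_ (q n) L)[N3 N3P].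
  pose i := (N0 + N1 + N2 + N3)%N.
  have iN0 : (N0 <= i)%N by rewrite /i; lia.
  have iN1 : (N1 <= i)%N by rewrite /i; lia.
  have iN2 : (N2 <= i)%N by rewrite /i; lia.
  have iN3 : (N3 <= i)%N by rewrite /i; lia.
  have := gromov_product_fix delta_hyp delta0 (xyM _ _ iN0 iN0)
    (N2P _ _ iN2 iN2) (N3P _ _ iN3 iN3).
  rewrite -/(q n) => qL.
  have sL : gromov_product s (x i) (y i) <= L.
    apply: le_trans (xyM _ _ iN0 iN0) _.
    by rewrite /L -addrA lerDl addr_ge0// mulr_ge0.
  apply: le_trans (ler_distD `|mdist (x i) (q n) - mdist (x i) s| _ _) _.
  apply: lerD (busemann_dist qL sL) _.
  exact: le_trans (ler_dist_dist _ _) (N1P i iN1).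
have [n nf] : exists n, 8 * delta < `|f n|.
  apply: contrapT => /forallNP bounded; apply: (unb s).
  have D n : mdist (q n) s <= 8 * delta + C.
    have /negP := bounded n; rewrite -leNgt => fn.
    by have := lerD (le_trans (ler_norm _) (fD n)) fn; rewrite subrK addrC.
  have DG h : cyclic_subgroup g h -> mdist (rho h s) s <= 8 * delta + C.
    move=> [n [|]->]; first exact: D.
    by have := D n; rewrite -mdist_power_orbitV0 /power_orbit expVgn.
  exists (2 * (8 * delta + C)) => h k /DG hs /DG ks.
  have := metric_triangle (rho h s) s (rho k s).
  by rewrite (metric_sym s (rho k s)); lra.
(* The sign depends on whether [x] represents the repelling or the attracting point; the negative of
   [f] has the same defect and absolute value. *)
have [fn|fn] : 8 * delta < f n \/ 8 * delta < - f n.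
- by apply/orP; rewrite -ltr_normr.
- exact: quasimorphism_axial fqm fD (quasimorphism_diverges fqm fn).
- have fqmN k m : `|- f (k + m)%N - - f k - - f m| <= 8 * delta.
    by rewrite -normrN !opprD !opprK.
  apply: (@quasimorphism_axial _ _ _ _ (fun k => - f k) _ C _ _ fqmN).
    by move=> k; rewrite normrN.
  exact: quasimorphism_diverges fqmN fn.
Qed.

End LoxodromicAxial.

(** * Tight functions *)

Section TightSpan.
Variables (R : realType) (S : metricType R).
Implicit Types (h f : S -> R) (x y z : S).

Definition admissible h := forall x y, mdist x y <= h x + h y.

(** For an admissible function this is minimality, with the supremum of [mdist x y - h y] approached
    rather than attained. *)
Definition tight h := forall x e, 0 < e -> exists y, h x + h y < mdist x y + e.

Definition conjugate h x := sup [set mdist x z - h z | z in setT].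

(** The conjugate alone may fail to be admissible. The mean is admissible, since each of
    [h x + conjugate h y] and [h y + conjugate h x] is at least [mdist x y]. *)
Definition conjugate_mean h x := (h x + conjugate h x) / 2.

(* Starting from an admissible [h], the iterates decrease, and the gap between
   an iterate and its conjugate is twice the size of the next decrement; hence
   the limit is tight. *)
Definition tighten h x := inf [set iter n conjugate_mean h x | n in setT].

Lemma admissible_ge0 h x : admissible h -> 0 <= h x.
Proof. by move=> /(_ x x); rewrite mdistxx; lra. Qed.

Lemma conjugate_ge h x z : admissible h -> mdist x z - h z <= conjugate h x.
Proof.
move=> hadm; apply: ub_le_sup; last by exists z.
by exists (h x) => _ [w _ <-]; have := hadm x w; lra.
Qed.

Lemma conjugate_le_ub h x c :
  (forall z, mdist x z - h z <= c) -> conjugate h x <= c.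
Proof.
move=> hc; apply: ge_sup; last by move=> _ [z _ <-].
by exists (mdist x x - h x), x.
Qed.

Lemma conjugate_le h x : admissible h -> conjugate h x <= h x.
Proof.
by move=> hadm; apply: conjugate_le_ub => z; have := hadm x z; lra.
Qed.

Lemma conjugate_mean_le h x : admissible h -> conjugate_mean h x <= h x.
Proof. by move=> /(@conjugate_le _ x); rewrite /conjugate_mean; lra. Qed.

Lemma conjugate_mean_admissible h : admissible h -> admissible (conjugate_mean h).
Proof.
move=> hadm x y; have := conjugate_ge x y hadm; have := conjugate_ge y x hadm.
by rewrite /conjugate_mean (metric_sym y x); lra.
Qed.

Lemma iter_conjugate_mean_admissible h n :
  admissible h -> admissible (iter n conjugate_mean h).
Proof. by move=> hadm; elim: n => //= n; exact: conjugate_mean_admissible. Qed.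

Lemma iter_conjugate_mean_le h m n x : admissible h -> (m <= n)%N ->
  iter n conjugate_mean h x <= iter m conjugate_mean h x.
Proof.
move=> hadm /subnK <-; elim: (n - m)%N => //= k; apply: le_trans.
exact/conjugate_mean_le/iter_conjugate_mean_admissible.
Qed.

Lemma tighten_le h n x : admissible h -> tighten h x <= iter n conjugate_mean h x.
Proof.
move=> hadm; apply: ge_inf; last by exists n.
exists 0 => _ [m _ <-].
exact/admissible_ge0/iter_conjugate_mean_admissible.
Qed.

Lemma tighten_ge h x c :
  (forall n, c <= iter n conjugate_mean h x) -> c <= tighten h x.
Proof.
move=> ch; apply: lb_le_inf; last by move=> _ [n _ <-].
by exists (h x), 0%N.
Qed.

Lemma tighten_admissible h : admissible h -> admissible (tighten h).
Proof.
move=> hadm x y; rewrite -lerBlDr; apply: tighten_ge => m.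
rewrite lerBlDr addrC -lerBlDr; apply: tighten_ge => n; rewrite lerBlDr.
(* The two infima use different indices; as the iterates decrease, the larger index serves both. *)
have := iter_conjugate_mean_admissible (maxn n m) hadm y x.
rewrite (metric_sym y x) => /le_trans; apply; apply: lerD.
  by apply: iter_conjugate_mean_le; rewrite ?leq_maxl.
by apply: iter_conjugate_mean_le; rewrite ?leq_maxr.
Qed.

Lemma tighten_tight h : admissible h -> tight (tighten h).
Proof.
move=> hadm x e e0.
have [_ [n _ <-]] : exists2 r, [set iter n conjugate_mean h x | n in setT] r &
    r < tighten h x + e / 3.
  apply: inf_adherent; first by rewrite divr_gt0.
  split; first by exists (h x), 0%N.
  exists 0 => _ [m _ <-].
  exact/admissible_ge0/iter_conjugate_mean_admissible.
set hn := iter n _ h => hn_lt.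
have hn_adm : admissible hn by exact: iter_conjugate_mean_admissible.
(* The next iterate is still above the limit, which forces the conjugate of [hn] at [x] above
   [tighten h x - e / 3]. *)
have mean_ge : tighten h x <= (hn x + conjugate hn x) / 2.
  exact: (@tighten_le _ n.+1).
have [_ [z _ <-]] : exists2 r, [set mdist x z - hn z | z in setT] r &
    conjugate hn x - e / 3 < r.
  apply: sup_adherent; first by rewrite divr_gt0.
  split; first by exists (mdist x x - hn x), x.
  by exists (hn x) => _ [w _ <-]; have := hn_adm x w; lra.
exists z; have := @tighten_le h n z hadm; rewrite -/hn.
lra.
Qed.

Lemma conjugate_tight h x : admissible h -> tight h -> conjugate h x = h x.
Proof.
move=> hadm ht; apply/le_anti; rewrite conjugate_le//=.
apply/ler_addgt0Pr => e e0; have [y xy] := ht x e e0.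
by have := conjugate_ge x y hadm; lra.
Qed.

Lemma tighten_id h : admissible h -> tight h -> tighten h = h.
Proof.
move=> hadm ht.
have mean_id : conjugate_mean h = h.
  by apply/funext => x; rewrite /conjugate_mean conjugate_tight//; lra.
have iter_id n : iter n conjugate_mean h = h by elim: n => //= n ->.
apply/funext => x; apply/le_anti/andP; split.
  by rewrite -{2}(iter_id 0%N); exact: tighten_le.
by apply: tighten_ge => n; rewrite iter_id.
Qed.

Lemma conjugate_mean_lipschitz h f c : admissible h -> admissible f ->
  (forall x, `|h x - f x| <= c) ->
  forall x, `|conjugate_mean h x - conjugate_mean f x| <= c.
Proof.
move=> hadm fadm hf x.
have conj_le k l : admissible l -> (forall x, `|k x - l x| <= c) ->
    conjugate k x <= conjugate l x + c.
  move=> ladm kl; apply: conjugate_le_ub => z.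
  by have := conjugate_ge x z ladm; have := kl z; rewrite ler_norml; lra.
have := conj_le h f fadm hf.
have : conjugate f x <= conjugate h x + c.
  by apply: conj_le => // y; rewrite distrC.
by have := hf x; rewrite /conjugate_mean !ler_norml; lra.
Qed.

(** Together with [tighten_id] this makes [tighten] a 1-Lipschitz retraction onto the tight
    functions. *)
Lemma tighten_lipschitz h f c : admissible h -> admissible f ->
  (forall x, `|h x - f x| <= c) -> forall x, `|tighten h x - tighten f x| <= c.
Proof.
move=> hadm fadm hf x.
have iter_le n y :
    `|iter n conjugate_mean h y - iter n conjugate_mean f y| <= c.
  elim: n y => //= n IHn; apply: conjugate_mean_lipschitz => //;
  exact: iter_conjugate_mean_admissible.
have fh : tighten h x - c <= tighten f x.
  apply: tighten_ge => n; have := tighten_le n x hadm; have := iter_le n x.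
  by rewrite ler_norml; lra.
have hf' : tighten f x - c <= tighten h x.
  apply: tighten_ge => n; have := tighten_le n x fadm; have := iter_le n x.
  by rewrite ler_norml; lra.
by rewrite ler_norml; apply/andP; split; lra.
Qed.

(** Surjectivity of the isometry [phi] lets the supremum in each conjugate be reindexed by it. *)
Lemma tighten_invariant (phi : S -> S) h : admissible h ->
  (forall x y, mdist (phi x) (phi y) = mdist x y) ->
  (forall y, exists x, y = phi x) ->
  (forall x, h (phi x) = h x) -> forall x, tighten h (phi x) = tighten h x.
Proof.
move=> hadm iso surj hphi x.
suff iter_inv n y :
    iter n conjugate_mean h (phi y) = iter n conjugate_mean h y.
  by congr inf; apply/seteqP; split=> _ [n _ <-]; exists n.
elim: n y => //= n; set k := iter n _ h => IHn y.
have kadm : admissible k by exact: iter_conjugate_mean_admissible.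
rewrite /conjugate_mean IHn; congr ((_ + _) / _); apply/le_anti/andP; split.
  apply: conjugate_le_ub => z; have [w ->] := surj z.
  by rewrite iso IHn; exact: conjugate_ge.
by apply: conjugate_le_ub => z; rewrite -iso -IHn; exact: conjugate_ge.
Qed.

Lemma tight_lipschitz h x y : admissible h -> tight h -> h x <= h y + mdist x y.
Proof.
move=> hadm ht; apply/ler_addgt0Pr => e e0; have [z xz] := ht x e e0.
by have := hadm y z; have := metric_triangle x y z; lra.
Qed.

(** Distance functions are the image of [S] under its canonical embedding in the tight span. *)
Lemma tight_mdist s : tight (fun x => mdist x s).
Proof. by move=> x e e0; exists s; rewrite mdistxx addr0 ltrDl. Qed.

Lemma admissible_mdist s : admissible (fun x => mdist x s).
Proof. by move=> x y; rewrite (metric_sym y s); exact: metric_triangle. Qed.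

End TightSpan.

(** * The space of invariant tight functions *)

Section InvariantTightSpan.
Variables (R : realType) (G : groupType) (S : metricType R).
Variables (rho : isometric_action G S) (N : normal_subgroup G).

Definition invariant (h : S -> R) := forall k, N k -> forall x, h (rho k x) = h x.

Record invariant_tight_span := InvariantTightSpan {
  span_fun :> S -> R ;
  span_admissible : admissible span_fun ;
  span_tight : tight span_fun ;
  span_invariant : invariant span_fun }.

Local Notation T := invariant_tight_span.
Implicit Types f g h : T.

Lemma span_eq f g : (forall x, f x = g x) -> f = g.
Proof.
case: f g => [f f1 f2 f3] [g g1 g2 g3] /= fg.
have fgE : f = g by exact/funext.
rewrite -fgE in g1 g2 g3 *.
by congr InvariantTightSpan; exact: Prop_irrelevance.
Qed.

Lemma tighten_span_invariant (h : S -> R) : admissible h -> invariant h ->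
  invariant (tighten h).
Proof.
move=> hadm hinv k Nk; apply: tighten_invariant => //.
- exact: iact_isom.
- by move=> y; exists (rho k^-1%g y); rewrite iactK.
- exact: hinv.
Qed.

Definition tighten_span (h : S -> R) (hadm : admissible h) (hinv : invariant h) : T :=
  InvariantTightSpan (tighten_admissible hadm) (tighten_tight hadm)
    (tighten_span_invariant hadm hinv).

(** * The sup metric and its hyperbolicity *)

Definition span_dist f g := sup [set `|f x - g x| | x in setT].

Lemma span_dist_ge f g x : `|f x - g x| <= span_dist f g.
Proof.
apply: ub_le_sup; last by exists x.
(* Since [f] is 1-Lipschitz, [f y] exceeds [f x] by at most [mdist y x], which is at most
   [g y + g x]; the other sign is symmetric. *)
exists (f x + g x) => _ [y _ <-]; rewrite ler_norml.
have := tight_lipschitz y x (@span_admissible f) (@span_tight f).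
have := tight_lipschitz y x (@span_admissible g) (@span_tight g).
have := @span_admissible f y x; have := @span_admissible g y x.
by move=> ? ? ? ?; apply/andP; split; lra.
Qed.

(** When [S] is empty the supremum is 0 by convention, whence the condition [0 <= c]. *)
Lemma span_dist_le f g c : 0 <= c -> (forall x, `|f x - g x| <= c) ->
  span_dist f g <= c.
Proof.
move=> c0 fg; rewrite /span_dist.
have [->|/set0P D0] := eqVneq [set `|f x - g x| | x in setT] set0.
  by rewrite sup0.
by apply: ge_sup => // _ [x _ <-].
Qed.

Lemma span_dist_ge0 f g : 0 <= span_dist f g.
Proof.
rewrite /span_dist.
have [->|/set0P[_ [x _ _]]] := eqVneq [set `|f x - g x| | x in setT] set0.
  by rewrite sup0.
exact: le_trans (normr_ge0 _) (span_dist_ge f g x).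
Qed.

Lemma span_distxx f : span_dist f f = 0.
Proof.
apply/le_anti; rewrite span_dist_ge0 andbT; apply: span_dist_le => // x.
by rewrite subrr normr0.
Qed.

Lemma span_dist_positivity f g : span_dist f g = 0 -> f = g.
Proof.
move=> fg; apply: span_eq => x; apply/eqP; rewrite -subr_eq0 -normr_le0 -fg.
exact: span_dist_ge.
Qed.

Lemma span_dist_sym f g : span_dist f g = span_dist g f.
Proof.
by apply/le_anti/andP; split; apply: span_dist_le; rewrite ?span_dist_ge0// => x;
  rewrite distrC; exact: span_dist_ge.
Qed.

Lemma span_dist_triangle g f h : span_dist f h <= span_dist f g + span_dist g h.
Proof.
apply: span_dist_le => [|x]; first by rewrite addr_ge0 ?span_dist_ge0.
by apply: le_trans (ler_distD (g x) _ _) _; rewrite lerD ?span_dist_ge.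
Qed.

HB.instance Definition _ := gen_eqMixin T.
HB.instance Definition _ := gen_choiceMixin T.
HB.instance Definition _ := @isMetric.Build R T
  span_dist span_distxx span_dist_positivity span_dist_sym span_dist_triangle.

Lemma mdist_spanE f g : mdist f g = span_dist f g. Proof. by []. Qed.

Lemma mdist_span_ge f g x y : mdist x y - f x - g y <= mdist f g.
Proof.
rewrite mdist_spanE; apply: le_trans (span_dist_ge f g y).
by apply: le_trans (ler_norm _); have := @span_admissible f x y; lra.
Qed.

(** With [mdist_span_ge], the distance of [f] and [g] is the supremum of [mdist x y - f x - g y]: by
    tightness, a value of one function is nearly a distance minus another of its values. The point
    [s] makes the supremum one of a nonempty set. *)
Lemma mdist_span_lt (s : S) f g e : 0 < e ->
  exists x y, mdist f g - e < mdist x y - f x - g y.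
Proof.
move=> e0; rewrite mdist_spanE.
have [_ [x _ <-]] : exists2 r, [set `|f x - g x| | x in setT] r &
    span_dist f g - e / 2 < r.
  apply: sup_adherent; first by rewrite divr_gt0.
  split; first by exists `|f s - g s|, s.
  by exists (span_dist f g) => _ [x _ <-]; exact: span_dist_ge.
have e2 : 0 < e / 2 by rewrite divr_gt0.
rewrite ltr_normr => /orP[fg|gf].
  have [y xy] := @span_tight f x _ e2; exists y, x.
  by rewrite (metric_sym y x); lra.
by have [y xy] := @span_tight g x _ e2; exists x, y; lra.
Qed.

(** Nearly optimal pairs for the distances [f] to [g] and [h] to [o] give four points of [S]. Their
    four-point inequality passes to the span because every pair of points bounds the matching
    distance from below. *)
Lemma span_four_point (s : S) (delta : R) :
  (forall s t r o : S, Num.min (gromov_product o s r) (gromov_product o r t) - delta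
    <= gromov_product o s t) ->
  forall f g h o : T, Num.min (gromov_product o f h) (gromov_product o h g) - delta
    <= gromov_product o f g.
Proof.
move=> delta_hyp f g h o.
suff : mdist f g + mdist h o <=
    Num.max (mdist f h + mdist g o) (mdist f o + mdist g h) + 2 * delta.
  rewrite lerBlDr ge_min /gromov_product (metric_sym h g) maxEle.
  case: ifP => _ ?; apply/orP; [right|left]; lra.
apply/ler_addgt0Pr => e e0; have e2 : 0 < e / 2 by rewrite divr_gt0.
have [x [y xy]] := mdist_span_lt s f g e2.
have [z [w zw]] := mdist_span_lt s h o e2.
have := mdist_span_ge f h x z; have := mdist_span_ge g o y w.
have := mdist_span_ge f o x w; have := mdist_span_ge g h y z.
have le1 : mdist f h + mdist g o <=
    Num.max (mdist f h + mdist g o) (mdist f o + mdist g h).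
  by rewrite le_max lexx.
have le2 : mdist f o + mdist g h <=
    Num.max (mdist f h + mdist g o) (mdist f o + mdist g h).
  by rewrite le_max lexx orbT.
by case: (four_point delta_hyp x y z w) => ? ? ? ? ?; lra.
Qed.

(** Affine combinations stay admissible and invariant but need not be tight, so they are tightened;
    the endpoints do not move. *)
Lemma span_geodesic : geodesic_space T.
Proof.
move=> f g; set D := mdist f g; have D0 : 0 <= D by exact: mdist_ge0.
(* The parameter is clamped so that the combination is admissible for every real [u]. *)
pose lam (u : R) := Num.max 0 (Num.min 1 (u / D)).
have lam01 u : 0 <= lam u <= 1.
  by rewrite /lam le_max lexx ge_max ge_min lexx ler01.
have lamD u : 0 <= u -> u <= D -> lam u * D = u.
  move=> u0 uD; have [DE|Dn0] := eqVneq D 0.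
    by rewrite DE mulr0; apply/le_anti; rewrite u0 -DE uD.
  have Dgt0 : 0 < D by rewrite lt_def Dn0.
  rewrite /lam min_r; last by rewrite ler_pdivrMr// mul1r.
  by rewrite max_r ?divr_ge0// divfK.
pose seg u x := (1 - lam u) * f x + lam u * g x.
have seg_adm u : admissible (seg u).
  move=> x y; have /andP[l0 l1] := lam01 u.
  have := @span_admissible f x y; have := @span_admissible g x y.
  rewrite -subr_ge0 => hg; rewrite -subr_ge0 => hf; rewrite -subr_ge0.
  have l1' : 0 <= 1 - lam u by lra.
  have := addr_ge0 (mulr_ge0 l1' hf) (mulr_ge0 l0 hg).
  by rewrite /seg; congr (0 <= _); ring.
have seg_inv u : invariant (seg u).
  by move=> k Nk x; rewrite /seg !span_invariant.
pose c u := tighten_span (seg_adm u) (@seg_inv u).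
have cE u h : (forall x, seg u x = h x) -> c u = h.
  move=> segE; apply: span_eq => x /=; rewrite (_ : seg u = h); last exact/funext.
  by rewrite tighten_id//; [exact: span_admissible|exact: span_tight].
have c0 : c 0 = f.
  by apply: cE => x; rewrite /seg /lam mul0r min_r// maxxx; ring.
have cD : c D = g.
  apply: cE => x; have := lamD D D0 (lexx D); rewrite /seg.
  have [/mdist_positivity -> _|Dn0] := eqVneq D 0; first by ring.
  by rewrite -[X in _ = X -> _]mul1r => /(mulIf Dn0) ->; ring.
have c_le u v : 0 <= u -> u <= D -> 0 <= v -> v <= D -> mdist (c u) (c v) <= `|u - v|.
  move=> u0 uD v0 vD; rewrite mdist_spanE; apply: span_dist_le => // x.
  apply: tighten_lipschitz => // {}x.
  have -> : seg u x - seg v x = (lam v - lam u) * (f x - g x).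
    by rewrite /seg; ring.
  have -> : `|u - v| = `|lam v - lam u| * D.
    by rewrite -(ger0_norm D0) -normrM mulrBl !lamD// distrC.
  by rewrite normrM ler_wpM2l// span_dist_ge.
exists c; split=> // u v; rewrite !in_itv/= => /andP[u0 uD] /andP[v0 vD].
apply/le_anti; rewrite c_le//=.
wlog uv : u v u0 uD v0 vD / u <= v.
  move=> H; have [/H ->//|/ltW vu] := leP u v.
  by rewrite distrC metric_sym H.
(* The pieces from [f] to [c u], to [c v], to [g] have lengths at most [u], [v - u], [D - v]. These
   add up to [D], so the middle bound is attained. *)
have := c_le 0 u (lexx 0) D0 u0 uD; rewrite sub0r normrN (ger0_norm u0) c0.
have := c_le v D v0 vD D0 (lexx D); rewrite cD.
rewrite (distrC v D) (distrC u v) !ger0_norm ?subr_ge0//.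
have := metric_triangle f (c u) g; have := metric_triangle (c u) (c v) g.
by rewrite -/D; lra.
Qed.

Lemma span_hyperbolic (s : S) : hyperbolic S -> hyperbolic T.
Proof.
move=> [_ [delta delta0 delta_hyp]]; split; first exact: span_geodesic.
by exists delta => //; exact (span_four_point s delta_hyp).
Qed.

(** * The action of the quotient group *)

Lemma span_shift_admissible f a : admissible (f \o rho a).
Proof. by move=> x y /=; rewrite -(iact_isom rho a); exact: span_admissible. Qed.

Lemma span_shift_tight f a : tight (f \o rho a).
Proof.
move=> x e e0; have [y xy] := @span_tight f (rho a x) e e0.
by exists (rho a^-1%g y); rewrite /= iactK -(iact_isom rho a) iactK.
Qed.

(** Normality moves [k] past [a] as a conjugate, still in [N]. *)
Lemma span_shift_invariant f a : invariant (f \o rho a).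
Proof.
move=> k Nk x /=; rewrite -iactM (_ : (a * k = (k ^ a^-1) * a)%g).
  by rewrite iactM span_invariant//; exact: nsubJ.
by rewrite /conjg invgK -!mulgA mulVg mulg1.
Qed.

Definition span_shift a f : T := InvariantTightSpan
  (@span_shift_admissible f a) (@span_shift_tight f a) (@span_shift_invariant f a).

Lemma mdist_span_shift a f g : mdist (span_shift a f) (span_shift a g) = mdist f g.
Proof.
rewrite !mdist_spanE; congr sup; apply/seteqP; split=> _ [x _ <-] /=.
  by exists (rho a x).
by exists (rho a^-1%g x); rewrite //= iactK.
Qed.

Local Notation Q := (quotient_group N).

(** The inverse turns precomposition into a left action; on invariant functions the choice of
    representative has no effect. *)
Definition span_iact (u : Q) f : T := span_shift (repr u)^-1%g f.

Lemma span_iact_pi a f x : span_iact (\pi_Q a)%qT f x = f (rho a^-1%g x).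
Proof.
rewrite /span_iact /=; set r := repr _.
have -> : (r^-1 = (a^-1 * r)^-1 * a^-1)%g by rewrite invgM invgK mulgK.
by rewrite iactM span_invariant//; apply: nsubV; exact: coset_repr.
Qed.

Lemma span_iact1 f : span_iact 1%g f = f.
Proof. by apply: span_eq => x; rewrite span_iact_pi invg1 iact1. Qed.

Lemma span_iactM (u v : Q) f : span_iact (u * v)%g f = span_iact u (span_iact v f).
Proof.
elim/quot_ind: u => a; elim/quot_ind: v => b; apply: span_eq => x.
rewrite -[(_ * _)%g]/(quot_mul _ _) -pi_quot_mul !span_iact_pi.
by rewrite invgM iactM.
Qed.

Lemma span_iact_isom (u : Q) f g : mdist (span_iact u f) (span_iact u g) = mdist f g.
Proof. exact: mdist_span_shift. Qed.

Definition span_action : isometric_action Q T :=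
  IsometricAction span_iact1 span_iactM span_iact_isom.

End InvariantTightSpan.

(** * A fixed point of a normal subgroup with bounded orbits *)

Lemma asymptotic_transfer (R : realType) (S T : metricType R) (o : S) (o' : T)
  (x y : nat -> S) (x' y' : nat -> T) (C : R) :
  (forall n, `|mdist (x n) o - mdist (x' n) o'| <= C) ->
  (forall n, `|mdist (y n) o - mdist (y' n) o'| <= C) ->
  (forall i j, `|mdist (x i) (y j) - mdist (x' i) (y' j)| <= C) ->
  asymptotic x y -> asymptotic x' y'.
Proof.
move=> xC yC xyC /asymptoticP/(_ o) xy; apply: (@asymptotic_base _ _ o') => M.
have [N NM] := xy (M + 2 * C); exists N => i j Ni Nj.
have := NM i j Ni Nj; have := xyC i j; have := xC i; have := yC j.
rewrite /gromov_product !ler_norml.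
by move=> /andP[? ?] /andP[? ?] /andP[? ?] ?; lra.
Qed.

Section BoundedNormalSubgroup.
Variables (R : realType) (G : groupType) (S : metricType R).
Variables (rho : isometric_action G S) (N : normal_subgroup G) (s : S) (B : R).
Hypothesis orbit_bounded : forall k, N k -> mdist s (rho k s) <= B.

Local Notation T := (invariant_tight_span rho N).
Local Notation Q := (quotient_group N).

(** An [N]-invariant replacement for the distance to [s], from which it differs by at most [B]. *)
Definition orbit_radius (x : S) := sup [set mdist x (rho k s) | k in nsub_set N].

Lemma orbit_radius_ub x : ubound [set mdist x (rho k s) | k in nsub_set N]
  (mdist x s + B).
Proof.
move=> _ [k Nk <-]; apply: le_trans (metric_triangle x s (rho k s)) _.
by rewrite lerD2l orbit_bounded.
Qed.

Lemma orbit_radius_ge x k : N k -> mdist x (rho k s) <= orbit_radius x.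
Proof.
move=> Nk; apply: ub_le_sup; last by exists k.
by exists (mdist x s + B); exact: orbit_radius_ub.
Qed.

Lemma orbit_radius_le x : orbit_radius x <= mdist x s + B.
Proof.
apply: ge_sup; last exact: orbit_radius_ub.
by exists (mdist x (rho 1%g s)), 1%g => //; exact: nsub1.
Qed.

Lemma orbit_radius_admissible : admissible orbit_radius.
Proof.
move=> x y; apply: le_trans (metric_triangle x s y) _; rewrite (metric_sym s y).
by apply: lerD; rewrite -{1}(iact1 rho s) orbit_radius_ge//; exact: nsub1.
Qed.

Lemma orbit_radius_invariant : invariant rho N orbit_radius.
Proof.
move=> k Nk x; congr sup; apply/seteqP; split=> _ [l Nl <-].
  exists (k^-1 * l)%g; first by apply: nsubM => //; exact: nsubV.
  by rewrite iactM -(iact_isom rho k) iactK.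
by exists (k * l)%g; [exact: nsubM|rewrite iactM iact_isom].
Qed.

Definition orbit_center : T :=
  tighten_span orbit_radius_admissible orbit_radius_invariant.

(** The distance to [s] is its own tightening, so the bound for [orbit_radius] survives the
    1-Lipschitz retraction. *)
Lemma orbit_center_near x : `|orbit_center x - mdist x s| <= B.
Proof.
rewrite -[mdist x s]/((fun y => mdist y s) x).
rewrite -(tighten_id (@admissible_mdist _ _ s) (@tight_mdist _ _ s)).
apply: tighten_lipschitz => [||y]; first exact: orbit_radius_admissible.
  exact: admissible_mdist.
rewrite ger0_norm ?subr_ge0; first by rewrite lerBlDl orbit_radius_le.
by rewrite -{1}(iact1 rho s) orbit_radius_ge//; exact: nsub1.
Qed.

(** The translate of the centre by the class of [a] is within [B] of the distance to [rho a s], and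
    likewise for [b]. *)
Lemma mdist_orbit_center (a b : G) :
  `|mdist (rho a s) (rho b s) - mdist (span_action rho N (\pi_Q a)%qT orbit_center)
    (span_action rho N (\pi_Q b)%qT orbit_center)| <= 2 * B.
Proof.
have B0 : 0 <= B.
  by apply: le_trans (orbit_bounded (nsub1 N)); exact: mdist_ge0.
have dist_base c x : mdist (rho c^-1%g x) s = mdist x (rho c s).
  by rewrite -(iact_isom rho c) iactK.
have near c x := orbit_center_near (rho c^-1%g x).
rewrite mdist_spanE ler_norml; apply/andP; split.
  rewrite lerNl opprB lerBlDr; apply: span_dist_le => [|x].
    by rewrite addr_ge0 ?mdist_ge0// mulr_ge0.
  rewrite !span_iact_pi; have := near a x; have := near b x.
  rewrite !dist_base !ler_norml.
  have := metric_triangle x (rho a s) (rho b s).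
  have := metric_triangle x (rho b s) (rho a s).
  rewrite (metric_sym (rho b s) (rho a s)).
  by move=> ? ? /andP[? ?] /andP[? ?]; apply/andP; split; lra.
rewrite lerBlDr -lerBlDl.
(* At [rho a s] the two translates are within [B] of 0 and of the distance between the orbit
   points. *)
apply: le_trans (span_dist_ge _ _ (rho a s)); rewrite distrC.
apply: le_trans (ler_norm _); rewrite !span_iact_pi.
have := near a (rho a s); have := near b (rho a s).
rewrite !dist_base mdistxx !ler_norml.
by move=> /andP[? ?] /andP[? ?]; lra.
Qed.

Lemma mdist_orbit_center1 (a : G) :
  `|mdist (rho a s) s - mdist (span_action rho N (\pi_Q a)%qT orbit_center)
    orbit_center| <= 2 * B.
Proof.
have base1 : span_action rho N (\pi_Q 1%g)%qT orbit_center = orbit_center.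
  by apply: span_eq => x; rewrite span_iact_pi invg1 iact1.
by have := mdist_orbit_center a 1%g; rewrite base1 iact1.
Qed.

Lemma orbit_center_asymptotic (u v : nat -> G) :
  asymptotic (fun n => span_action rho N (\pi_Q (u n))%qT orbit_center)
    (fun n => span_action rho N (\pi_Q (v n))%qT orbit_center) <->
  asymptotic (fun n => rho (u n) s) (fun n => rho (v n) s).
Proof.
split.
- apply: (@asymptotic_transfer _ _ _ orbit_center s _ _ _ _ (2 * B)) => [n|n|i j];
    rewrite distrC.
  + exact: mdist_orbit_center1.
  + exact: mdist_orbit_center1.
  + exact: mdist_orbit_center.
- apply: (@asymptotic_transfer _ _ _ s orbit_center _ _ _ _ (2 * B)) => [n|n|i j].
  + exact: mdist_orbit_center1.
  + exact: mdist_orbit_center1.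
  + exact: mdist_orbit_center.
Qed.

End BoundedNormalSubgroup.

(** * The quotient by the elliptic radical *)

Section EllipticRadicalQuotient.
Variables (R : realType) (G : groupType) (S : metricType R).
Variable rho : isometric_action G S.
Implicit Types g h : G.

Variable delta : R.
Hypothesis delta_hyp : forall s t r o : S,
  Num.min (gromov_product o s r) (gromov_product o r t) - delta
    <= gromov_product o s t.
Hypothesis delta0 : 0 <= delta.

Lemma axial_endpoint g g1 s : axial rho g s -> g1 = g \/ g1 = g^-1%g ->
  cvg_at_infinity (power_orbit rho g1 s) /\
  boundary_fix rho [set g] (boundary_point (power_orbit rho g1 s)).
Proof.
move=> [pc mc _] [|]->; split=> //; apply/boundary_fix1P; split.
- exact: boundary_boundary_point.
- by apply/(bact_fixP rho delta_hyp g pc); exact: power_orbit_fix.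
- exact: boundary_boundary_point.
- by apply/(bact_fixP rho delta_hyp g mc); exact: power_orbitV_fix.
Qed.

(** A shared endpoint would be fixed by both [g] and [h]. *)
Lemma axial_endpoints_neq g h s g1 h1 : axial rho g s -> axial rho h s ->
  boundary_fix rho [set g] `&` boundary_fix rho [set h] = set0 ->
  g1 = g \/ g1 = g^-1%g -> h1 = h \/ h1 = h^-1%g ->
  ~ asymptotic (power_orbit rho g1 s) (power_orbit rho h1 s).
Proof.
move=> gs hs gh /(axial_endpoint gs)[_ gfix] /(axial_endpoint hs)[_ hfix].
move=> /(boundary_point_eq delta_hyp) gh1; rewrite -gh1 in hfix.
suff : set0 (boundary_point (power_orbit rho g1 s)) by [].
by rewrite -gh; split.
Qed.

(** Both endpoints of [g] and one of [h] are distinct limit points, all fixed by the radical. *)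
Lemma elliptic_radical_bounded s : general_type rho ->
  exists B, forall k, elliptic_radical rho k -> mdist s (rho k s) <= B.
Proof.
move=> [_ [g [h [/(loxodromic_axial delta_hyp delta0 s) gs
  /(loxodromic_axial delta_hyp delta0 s) hs gh]]]].
have [pc mc npm] := gs; have [hc _ _] := hs.
have nph := axial_endpoints_neq gs hs gh (or_introl erefl) (or_introl erefl).
have nmh := axial_endpoints_neq gs hs gh (or_intror erefl) (or_introl erefl).
apply: (fix3_bounded delta_hyp delta0 (A := elliptic_radical rho) s
  pc mc hc npm nmh nph) => k Ek.
have fix_orbit f : cvg_at_infinity (power_orbit rho f s) ->
    asymptotic (rho k \o power_orbit rho f s) (power_orbit rho f s).
  move=> fc; apply/(bact_fixP rho delta_hyp k fc); apply: Ek; split.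
    exact: boundary_boundary_point.
  exists s, (power_orbit rho f s); split=> // n.
  by exists (f ^+ n)%g.
by split; exact: fix_orbit.
Qed.

Local Notation N := (elliptic_radical rho).
Local Notation T := (invariant_tight_span rho N).
Local Notation Q := (quotient_group N).
Local Notation pi g := ((\pi_Q g)%qT : Q).
Local Notation sigma := (span_action rho N).

Variables (s : S) (B : R).
Hypothesis radical_bounded : forall k, N k -> mdist s (rho k s) <= B.
Local Notation c := (orbit_center radical_bounded).

Lemma piM g h : pi (g * h)%g = (pi g * pi h)%g.
Proof. exact: pi_quot_mul. Qed.

Lemma piX g n : (pi g ^+ n)%g = pi (g ^+ n)%g.
Proof. by elim: n => // n IHn; rewrite !expgS IHn piM. Qed.

Lemma piV g : (pi g)^-1%g = pi g^-1%g.
Proof. by rewrite pi_quot_inv. Qed.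

Lemma power_orbit_pi g :
  power_orbit sigma (pi g) c = fun n => sigma (pi (g ^+ n)%g) c.
Proof. by apply/funext => n; rewrite /power_orbit piX. Qed.

Lemma power_orbit_asymptotic g h :
  asymptotic (power_orbit sigma (pi g) c) (power_orbit sigma (pi h) c)
  <-> asymptotic (power_orbit rho g s) (power_orbit rho h s).
Proof. by rewrite !power_orbit_pi; exact: orbit_center_asymptotic. Qed.

Lemma axial_pi g : axial rho g s -> axial sigma (pi g) c.
Proof.
move=> [pc mc npm]; split; first exact/power_orbit_asymptotic.
  by rewrite piV; apply/power_orbit_asymptotic.
by rewrite piV => /power_orbit_asymptotic.
Qed.

Hypothesis rho_general : general_type rho.

Let span_hyp := span_four_point (rho := rho) (N := N) s delta_hyp.

Lemma span_general_type : general_type sigma.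
Proof.
have [_ [g [h [glox hlox gh]]]] := rho_general.
have gs := loxodromic_axial delta_hyp delta0 s glox.
have hs := loxodromic_axial delta_hyp delta0 s hlox.
have gc := axial_pi gs; have hc := axial_pi hs.
have gclox := axial_loxodromic span_hyp delta0 gc.
split.
  move=> t [M tM]; have [unb _] := gclox; apply: (unb t).
  by exists M => u v _ _; exact: tM.
exists (pi g), (pi h); split => //.
  exact (axial_loxodromic span_hyp delta0 hc).
(* A common fixed point would be an endpoint of both axial elements; carried back to [S], it would
   make endpoints of [g] and [h] coincide. *)
apply/seteqP; split=> // a [/boundary_fix1P[ba ga] /boundary_fix1P[_ ha]].
have endpoint f : axial sigma (pi f) c -> bact sigma (pi f) a = a ->
    exists2 f1, f1 = f \/ f1 = f^-1%g &
    cvg_at_infinity (power_orbit sigma (pi f1) c) /\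
    a = boundary_point (power_orbit sigma (pi f1) c).
  move=> fc fa; have [pc mc _] := fc; rewrite piV in mc.
  have [aE|] := axial_fix span_hyp delta0 fc ba fa.
    by exists f; [left|exact (conj pc aE)].
  by rewrite piV => aE; exists f^-1%g; [right|exact (conj mc aE)].
have [g1 g1E [_ aE]] := endpoint g gc ga.
have [h1 h1E [h1c]] := endpoint h hc ha; rewrite aE.
move=> /(boundary_point_asymptotic h1c)/power_orbit_asymptotic.
exact: axial_endpoints_neq gs hs gh g1E h1E.
Qed.

(** A limit point in [S] and one in the span are matched by using the same group elements on [s] and
    on [c], so equal actions on the span's limit set force equal actions on that of [S]. *)
Lemma span_faithful : faithful_on_limit_set sigma.
Proof.
elim/quot_ind => g; elim/quot_ind => h gh.
suff fix_rho a : limit_set rho a -> bact rho g a = bact rho h a.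
  apply/coset_eqP/coset_relP => a La.
  by rewrite bactM -fix_rho// -bactM mulVg bact1.
move=> [ba [t [x [/choice[u xu] ax]]]].
have [xc aE] := boundary_point_of delta_hyp ba ax.
pose y n := rho (u n) s.
(* The orbit of [t] is exchanged for that of [s], where the comparison with [c] is available. *)
have xy n : mdist (x n) (y n) <= mdist t s by rewrite xu iact_isom.
have yc : cvg_at_infinity y by exact: asymptotic_bounded xc.
have {}aE : a = boundary_point y.
  rewrite aE; apply: boundary_point_eq => //.
  apply: asymptotic_bounded xc => [n|//]; rewrite mdistxx.
  exact: mdist_ge0.
pose z n := sigma (pi (u n)) c.
have zc : cvg_at_infinity z by exact/orbit_center_asymptotic.
have Lz : limit_set sigma (boundary_point z).
  split; first exact: boundary_boundary_point.
  by exists c, z; split=> // n; exists (pi (u n)).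
have shiftE f : sigma (pi f) \o z = fun n => sigma (pi (f * u n)%g) c.
  by apply/funext => n; rewrite piM iactM.
have rhoE f : rho f \o y = fun n => rho (f * u n)%g s.
  by apply/funext => n; rewrite /y /= iactM.
have := gh _ Lz; rewrite !bact_boundary_point => /boundary_point_asymptotic.
move=> /(_ (asymptotic_iact sigma _ zc)); rewrite !shiftE.
move=> /orbit_center_asymptotic; rewrite -!rhoE aE !bact_boundary_point.
exact: boundary_point_eq.
Qed.

End EllipticRadicalQuotient.

Theorem proposition1p1 (R : realType) (G : groupType) (S : metricType R)
  (rho : isometric_action G S) :
  hyperbolic S -> general_type rho ->
  faithful_weakly_hyperbolic R (quotient_group (elliptic_radical rho)).
Proof.
move=> hypS gt; have [_ [delta delta0 delta_hyp]] := hypS.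
(* A fixed boundary point of a loxodromic element is represented by a sequence, which supplies a
   point of [S]. *)
have [s] : exists s : S, True.
  have [_ [g [_ [[_ [a [b [_ fixab]]]] _ _]]]] := gt.
  have [[x _ _] _] : boundary_fix rho (cyclic_subgroup g) a.
    by rewrite fixab; left.
  by exists (x 0%N).
move=> _; have [B EB] := elliptic_radical_bounded delta_hyp delta0 s gt.
exists (invariant_tight_span rho (elliptic_radical rho)).
exists (span_action rho (elliptic_radical rho)); split.
- exact: span_hyperbolic.
- exact (span_general_type delta_hyp delta0 EB gt).
- exact (span_faithful delta_hyp EB).
Qed.
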